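(* Let $f(x) = \sum_{i=0}^\infty a_i x^i$ be a power series with real coefficients which converges absolutely on $[0,1]$ and satisfies $\frac{\log |a_i|}{i\log i}\to -\infty$ as $i\to\infty$ (with the convention $\log 0=-\infty$). Then the typical compact set $K\in\mathcal{K}([0,1])$ satisfies $\dim_{\mathrm H} f[K] = 0$; that is, the set of those $K\in\mathcal{K}([0,1])$ for which $\dim_{\mathrm H} f[K]\neq 0$ is meager in $\mathcal{K}([0,1])$.
   Context: $\mathcal{K}([0,1])$ is the space of nonempty compact subsets of $[0,1]$ with the Hausdorff metric. A property holds for the typical compact set $K\in\mathcal{K}([0,1])$ if the set of $K\in\mathcal{K}([0,1])$ not satisfying it is meager in $\mathcal{K}([0,1])$. For $A,B\subseteq\mathbb{R}$ and $c\in\mathbb{R}$, $A+B=\{a+b: a\in A, b\in B\}$ (Minkowski sum) and $cA=\{ca: a\in A\}$. For $A\subseteq\mathbb{R}$ and $n\in\mathbb{N}$ (including $n=0$), $[A]^{n}=\{\prod_{j=0}^{n-1}\alpha_j : \alpha_j\in A \text{ for } 0\le j<n\}$ is the $n$-fold Minkowski product of $A$ with itself, with $[A]^{0}=\{1\}$. For nonempty compact $K\subseteq[0,1]$ and a power series $f(x)=\sum_{i=0}^\infty a_i x^i$ absolutely convergent on $[0,1]$, $f[K]=\sum_{i=0}^\infty a_i [K]^{i}$, i.e. the limit with respect to the Hausdorff metric of the partial Minkowski sums $\sum_{i=0}^{n} a_i[K]^{i}$. $\dim_{\mathrm H}$ denotes Hausdorff dimension and $\log$ is the natural logarithm. *)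

(* Defs.v *)
From HB Require Import structures.
From mathcomp Require Import all_boot all_order all_algebra.
From mathcomp Require Import all_classical all_reals all_analysis.
From mathcomp Require Import lra.

Set Implicit Arguments.
Unset Strict Implicit.
Unset Printing Implicit Defensive.

Import Order.TTheory GRing.Theory Num.Theory numFieldNormedType.Exports.

Local Open Scope classical_set_scope.
Local Open Scope ring_scope.

(* [compacts X] is the hyperspace K(X) of nonempty compact subsets of X. *)
Record compacts (R : realType) (X : set R) := Compacts {
  carrier :> set R ;
  carrier_neq0 : carrier !=set0 ;
  carrier_compact : compact carrier ;
  carrier_sub : carrier `<=` X }.
Arguments carrier_neq0 {R X} K : rename.
Arguments carrier_compact {R X} K : rename.
Arguments carrier_sub {R X} K : rename.

HB.instance Definition _ (R : realType) (X : set R) :=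
  gen_eqMixin (compacts X).
HB.instance Definition _ (R : realType) (X : set R) :=
  gen_choiceMixin (compacts X).

Definition dist_set (R : realType) (x : R) (B : set R) : R :=
  inf [set `|x - y| | y in B].

Definition excess (R : realType) (A B : set R) : R :=
  sup [set dist_set x B | x in A].

Definition hausdorff_dist (R : realType) (A B : set R) : R :=
  Num.max (excess A B) (excess B A).

Section hausdorff_metric.
Context {R : realType}.
Implicit Types (x y e : R) (A B : set R).

Lemma dist_set_le x y B : B y -> dist_set x B <= `|x - y|.
Proof.
move=> By; apply: ge_inf; last by exists y.
by exists 0 => _ [z _ <-].
Qed.

Lemma le_dist_set x e B : B !=set0 -> (forall y, B y -> e <= `|x - y|) ->
  e <= dist_set x B.
Proof.
move=> [y By] h; apply: lb_le_inf; first by exists `|x - y|, y.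
by move=> _ [z Bz <-]; exact: h.
Qed.

Lemma dist_set_ge0 x B : B !=set0 -> 0 <= dist_set x B.
Proof. by move=> B0; apply: le_dist_set. Qed.

Lemma dist_set_lt x e B : B !=set0 -> dist_set x B < e ->
  exists2 y, B y & `|x - y| < e.
Proof.
move=> B0 Be; apply: contrapT => h; move: Be; apply/negP; rewrite -leNgt.
apply: le_dist_set => // y By; rewrite leNgt; apply/negP => xye.
by apply: h; exists y.
Qed.

Context {X : set R}.
Implicit Types K L M : compacts X.

Lemma carrier_bounded K : exists2 c : R, 0 < c & forall x, carrier K x -> `|x| <= c.
Proof.
have [c [_ h]] := compact_bounded (carrier_compact K).
exists (`|c| + 1) => [|x]; first by rewrite ltr_wpDl.
by apply: h; rewrite (le_lt_trans (ler_norm c))// ltrDl.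
Qed.

Lemma excess_leP K L e : excess K L <= e <-> forall x, carrier K x -> dist_set x L <= e.
Proof.
split=> [h x Kx|h]; last first.
  have [x Kx] := carrier_neq0 K.
  apply: ge_sup; first by exists (dist_set x L), x.
  by move=> _ [y Ky <-]; exact: h.
apply: le_trans h; apply: ub_le_sup; last by exists x.
have [c _ Kc] := carrier_bounded K; have [y Ly] := carrier_neq0 L.
exists (c + `|y|) => _ [z Kz <-].
by rewrite (le_trans (dist_set_le _ Ly))// (le_trans (ler_normB _ _))// lerD2r Kc.
Qed.

Lemma hausdorff_dist_leP K L e : hausdorff_dist K L <= e <->
  (forall x, carrier K x -> dist_set x L <= e) /\ (forall y, carrier L y -> dist_set y K <= e).
Proof.
rewrite /hausdorff_dist ge_max; split.
  by case/andP => /excess_leP ? /excess_leP ?.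
by case=> ? ?; apply/andP; split; apply/excess_leP.
Qed.

Lemma hausdorff_distxx K : hausdorff_dist K K = 0.
Proof.
apply/eqP; rewrite eq_le; apply/andP; split.
  by apply/hausdorff_dist_leP; split=> x Kx;
    rewrite (le_trans (dist_set_le x Kx))// subrr normr0.
have [/(_ _ _)/[swap] _ h] := (hausdorff_dist_leP K K _).1 (lexx _).
have [x Kx] := carrier_neq0 K.
by rewrite (le_trans _ (h x Kx))// dist_set_ge0//; exact: carrier_neq0.
Qed.

Lemma hausdorff_dist_sym K L : hausdorff_dist K L = hausdorff_dist L K.
Proof. by rewrite /hausdorff_dist maxC. Qed.

Lemma hausdorff_dist_triangle L K M :
  hausdorff_dist K M <= hausdorff_dist K L + hausdorff_dist L M.
Proof.
have tri (K1 K2 K3 : compacts X) e1 e2 :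
    (forall x, carrier K1 x -> dist_set x K2 <= e1) ->
    (forall x, carrier K2 x -> dist_set x K3 <= e2) ->
    forall x, carrier K1 x -> dist_set x K3 <= e1 + e2.
  move=> h1 h2 x Kx; rewrite -lerBlDr (le_trans _ (h1 x Kx))//.
  apply: le_dist_set => [|y Ky]; first exact: carrier_neq0.
  rewrite lerBlDr -lerBlDl (le_trans _ (h2 y Ky))//.
  apply: le_dist_set => [|z Kz]; first exact: carrier_neq0.
  by rewrite lerBlDl (le_trans (dist_set_le x Kz))// ler_distD.
have [h1 h1'] := (hausdorff_dist_leP K L _).1 (lexx _).
have [h2 h2'] := (hausdorff_dist_leP L M _).1 (lexx _).
apply/hausdorff_dist_leP; split; first exact: tri h1 h2.
by rewrite addrC; exact: tri h2' h1'.
Qed.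

Lemma dist_set_eq0 x K : dist_set x K <= 0 -> carrier K x.
Proof.
move=> h; have /closure_id -> : closed (K : set R).
  by apply: compact_closed; [exact: Rhausdorff|exact: carrier_compact].
move=> U /nbhs_ballP[e /= e0 xeU].
have [y Ky xye] := dist_set_lt (carrier_neq0 K) (le_lt_trans h e0).
by exists y; split => //; exact: xeU.
Qed.

Lemma compacts_eq K L : (K : set R) = L -> K = L.
Proof.
case: K L => [k k0 kc kX] [l l0 lc lX] /= kl; subst l.
by rewrite (Prop_irrelevance k0 l0) (Prop_irrelevance kc lc)
  (Prop_irrelevance kX lX).
Qed.

Lemma hausdorff_dist_positivity K L : hausdorff_dist K L = 0 -> K = L.
Proof.
move=> KL0; have := (hausdorff_dist_leP K L _).1 (lexx _); rewrite KL0 => -[h1 h2].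
apply: compacts_eq; apply/seteqP; split => x h; apply: dist_set_eq0.
  exact: h1.
exact: h2.
Qed.

End hausdorff_metric.

HB.instance Definition _ (R : realType) (X : set R) :=
  isMetric.Build R (compacts X) hausdorff_distxx hausdorff_dist_positivity
    hausdorff_dist_sym hausdorff_dist_triangle.

Definition nowhere_dense (T : topologicalType) (A : set T) : Prop :=
  (closure A)^° = set0.

Definition meager (T : topologicalType) (A : set T) : Prop :=
  exists2 F : (set T)^nat,
    forall n, nowhere_dense (F n) & A `<=` \bigcup_n F n.

Definition set_add (R : realType) (A B : set R) : set R :=
  [set a + b | a in A & b in B].

Definition set_scale (R : realType) (c : R) (A : set R) : set R :=
  [set c * a | a in A].

Definition set_pow (R : realType) (A : set R) (n : nat) : set R :=
  [set \prod_(j < n) alpha j | alpha in [set alpha : 'I_n -> R |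
                                         forall j, A (alpha j)]].

Definition powser_partial (R : realType) (a : R^nat) (A : set R) (n : nat) :
    set R :=
  \big[@set_add R/[set 0]]_(i < n.+1) set_scale (a i) (set_pow A i).

Section minkowski.
Context {R : realType}.
Implicit Types (A B C : set R).

Lemma set_addA : associative (@set_add R).
Proof.
move=> A B C; apply/seteqP; split=> x.
  move=> [a Aa [_ [b Bb [c Cc <-]] <-]]; exists (a + b).
    by exists a => //; exists b.
  by exists c => //; rewrite addrA.
move=> [_ [a Aa [b Bb <-]] [c Cc <-]]; exists a => //; exists (b + c).
  by exists b => //; exists c.
by rewrite addrA.
Qed.

Lemma set_addC : commutative (@set_add R).
Proof.
by move=> A B; apply/seteqP; split=> _ [a Aa [b Bb <-]]; exists b => //;
  exists a => //; rewrite addrC.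
Qed.

Lemma set_add0 : left_id [set 0] (@set_add R).
Proof.
move=> A; apply/seteqP; split=> [_ [c -> [b Bb <-]]|x Ax].
  by rewrite add0r.
by exists 0 => //; exists x => //; rewrite add0r.
Qed.

End minkowski.

HB.instance Definition _ (R : realType) :=
  Monoid.isComLaw.Build (set R) [set 0] (@set_add R)
    set_addA set_addC set_add0.

Section minkowski_compact.
Context {R : realType}.
Implicit Types (A B C : set R).

Lemma set_add_neq0 A B : A !=set0 -> B !=set0 -> set_add A B !=set0.
Proof. by move=> [a Aa] [b Bb]; exists (a + b), a => //; exists b. Qed.

Lemma image2_compact (f : R * R -> R) A B : continuous f ->
  compact A -> compact B -> compact [set f (a, b) | a in A & b in B].
Proof.
move=> cf cA cB.
have -> : [set f (a, b) | a in A & b in B] = f @` (A `*` B).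
  apply/seteqP; split=> x; first by move=> [a Aa [b Bb <-]]; exists (a, b).
  by move=> [[a b] [/= Aa Bb] <-]; exists a => //; exists b.
apply: continuous_compact; last exact: compact_setX.
exact: continuous_subspaceT.
Qed.

Lemma set_add_compact A B : compact A -> compact B -> compact (set_add A B).
Proof.
move=> cA cB; apply: (@image2_compact (fun x : R * R => x.1 + x.2)) => //.
by move=> x; apply: cvgD; [exact: cvg_fst|exact: cvg_snd].
Qed.

Lemma set_scale_neq0 c A : A !=set0 -> set_scale c A !=set0.
Proof. by move=> [a Aa]; exists (c * a), a. Qed.

Lemma set_scale_compact c A : compact A -> compact (set_scale c A).
Proof.
move=> cA; apply: (continuous_compact _ cA); apply: continuous_subspaceT.
by move=> x; apply: cvgM; [exact: cvg_cst|exact: cvg_id].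
Qed.

Lemma set_pow0 A : set_pow A 0 = [set 1].
Proof.
apply/seteqP; split=> [_ [al _ <-]|_ ->]; first by rewrite big_ord0.
by exists (fun=> 1); rewrite ?big_ord0// => -[].
Qed.

Lemma set_powS A n :
  set_pow A n.+1 = [set a * b | a in A & b in set_pow A n].
Proof.
apply/seteqP; split=> [_ [al Aal <-]|_ [a Aa [_ [al Aal <-] <-]]].
  exists (al ord0) => //; exists (\prod_(j < n) al (lift ord0 j)).
    by exists (fun j => al (lift ord0 j)).
  by rewrite big_ord_recl.
exists (fun j => if unlift ord0 j is Some k then al k else a) => /=.
  by move=> j; case: unliftP.
rewrite big_ord_recl unlift_none; congr (_ * _).
by apply: eq_bigr => j _; rewrite liftK.
Qed.

Lemma set_pow_neq0 A n : A !=set0 -> set_pow A n !=set0.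
Proof. by move=> [a Aa]; exists (\prod_(j < n) a), (fun=> a). Qed.

Lemma set_pow_compact A n : compact A -> compact (set_pow A n).
Proof.
move=> cA; elim: n => [|n ih]; first by rewrite set_pow0; exact: compact_set1.
rewrite set_powS; apply: (@image2_compact (fun x : R * R => x.1 * x.2)) => //.
by move=> x; apply: cvgM; [exact: cvg_fst|exact: cvg_snd].
Qed.

Lemma powser_partial_neq0 (a : R^nat) A n :
  A !=set0 -> powser_partial a A n !=set0.
Proof.
move=> A0; rewrite /powser_partial; elim/big_ind: _ => [||i _].
- by exists 0.
- exact: set_add_neq0.
- by apply: set_scale_neq0; exact: set_pow_neq0.
Qed.

Lemma powser_partial_compact (a : R^nat) A n :
  compact A -> compact (powser_partial a A n).
Proof.
move=> cA; rewrite /powser_partial; elim/big_ind: _ => [||i _].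
- exact: compact_set1.
- exact: set_add_compact.
- by apply: set_scale_compact; exact: set_pow_compact.
Qed.

Lemma powser_partialS (a : R^nat) A n : powser_partial a A n.+1 =
  set_add (powser_partial a A n) (set_scale (a n.+1) (set_pow A n.+1)).
Proof. by rewrite /powser_partial big_ord_recr. Qed.

End minkowski_compact.
Arguments powser_partial_compact {R} a [A] n _.

HB.instance Definition _ (R : realType) :=
  isPointed.Build (compacts [set: R])
    (Compacts (ex_intro [set 0] 0 erefl) (@compact_set1 R 0) (@subsetT _ _)).

Definition powser_partial_set (R : realType) (a : R^nat) (X : set R)
    (K : compacts X) (n : nat) : compacts [set: R] :=
  Compacts (powser_partial_neq0 a n (carrier_neq0 K))
    (powser_partial_compact a n (carrier_compact K)) (@subsetT _ _).

(* f[K] for f(x) = \sum_i a i * x ^+ i; the limit is taken in the Hausdorff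
   metric of K(R), and exists by [cvg_powser_image]. *)
Definition powser_image (R : realType) (a : R^nat)
    (K : compacts (`[0, 1] : set R)) : compacts [set: R] :=
  limn (powser_partial_set a K).

Section powser_image_cvg.
Context {R : realType} (a : R^nat) (K : compacts (`[0, 1] : set R)).
Context (a_cvg : forall x : R, 0 <= x <= 1 ->
  cvgn [normed series (fun i => a i * x ^+ i)]).

Let S n := powser_partial a K n.
Let r n := series (fun i => `|a i|) n.+1.
Let rho := limn (series (fun i => `|a i|)).

Let r_cvg : cvgn (series (fun i => `|a i|)).
Proof.
suff <- : (fun i => a i * 1 ^+ i) = a by apply: a_cvg; rewrite ler01 lexx.
by apply/funext => i; rewrite expr1n mulr1.
Qed.

Let rS n : r n.+1 = r n + `|a n.+1|.
Proof. by rewrite /r seriesSr. Qed.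

Let r_rho n : r n <= rho.
Proof.
apply: (@nondecreasing_cvgn_le _ (series (fun i => `|a i|)) _ r_cvg n.+1).
by apply/nondecreasing_seqP => m; rewrite seriesSr lerDl.
Qed.

Let term_le n t : set_scale (a n) (set_pow K n) t -> `|t| <= `|a n|.
Proof.
move=> [_ [al Kal <-] <-]; rewrite normrM normr_prod ler_piMr//.
apply: prodr_ile1 => j _; have := carrier_sub K _ (Kal j).
by rewrite /= in_itv/= => /andP[al0 al1]; rewrite normr_ge0 ger0_norm.
Qed.

Let S_back n m x : (n <= m)%N -> S m x ->
  exists2 y, S n y & `|x - y| <= r m - r n.
Proof.
move=> nm; rewrite -(subnKC nm); elim: (m - n)%N x => [|k ih] x.
  by rewrite addn0 => Sx; exists x => //; rewrite !subrr normr0.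
rewrite addnS /S powser_partialS => -[y Sy [t Tt <-]].
have [z Sz yz] := ih _ Sy; exists z => //.
rewrite rS addrAC [leRHS]addrAC (le_trans (ler_normD _ _))// lerD//.
exact: term_le.
Qed.

Let S_bound n x : S n x -> `|x| <= rho.
Proof.
move=> /(@S_back 0 n x (leq0n _))[y].
rewrite /S /powser_partial big_ord_recl big_ord0 Monoid.mulm1 => /term_le y0 xy.
rewrite (le_trans _ (r_rho n))// -(subrK y x) (le_trans (ler_normD _ _))//.
rewrite -[leRHS](subrK (r 0)) lerD//.
by rewrite /r seriesEnat /= big_nat1.
Qed.

Let S_forth al n m x : carrier K al -> (n <= m)%N -> S n x ->
  S m (x + (series (fun i => a i * al ^+ i) m.+1
            - series (fun i => a i * al ^+ i) n.+1)).
Proof.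
move=> Kal nm; rewrite -(subnKC nm); elim: (m - n)%N => [|k ih].
  by rewrite addn0 subrr addr0.
move=> Sx; rewrite addnS /S powser_partialS; eexists; first exact: ih.
exists (a (n + k).+1 * al ^+ (n + k).+1).
  eexists; last reflexivity.
  by exists (fun=> al) => //; rewrite prodr_const card_ord.
by rewrite (seriesSr _ (n + k).+1) -!addrA [X in x + (_ + X)]addrC.
Qed.

Let L : set R := [set x | forall e, 0 < e ->
  exists N, forall m, (N <= m)%N -> exists2 y, S m y & `|x - y| < e].

Let S_L n x : S n x -> exists2 y, L y & `|x - y| <= rho - r n.
Proof.
move=> Sx; have [al Kal] := carrier_neq0 K.
pose u := series (fun i => a i * al ^+ i).
have cu : cvgn u.
  apply: normed_cvg; apply: a_cvg.
  by have := carrier_sub K _ Kal; rewrite /= in_itv.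
have Dy m : (n <= m)%N -> `|x - (x + (u m.+1 - u n.+1))| <= rho - r n.
  move=> nm; rewrite opprD addNKr normrN.
  rewrite (@le_trans _ _ (r m - r n))//; last by rewrite lerD2r.
  rewrite -(subnKC nm); elim: (m - n)%N => [|k ih].
    by rewrite addn0 !subrr normr0.
  rewrite addnS rS /u (seriesSr _ (n + k).+1).
  rewrite addrAC [leRHS]addrAC (le_trans (ler_normD _ _))// lerD//.
  apply: term_le; eexists; last reflexivity.
  by exists (fun=> al) => //; rewrite prodr_const card_ord.
have cy : (fun m => x + (u m.+1 - u n.+1)) @ \oo --> x + (limn u - u n.+1).
  apply: cvgD; first exact: cvg_cst.
  by apply: cvgB; [rewrite cvg_shiftS|exact: cvg_cst].
exists (x + (limn u - u n.+1)).
  move=> e e0; move/cvgrPdist_lt : cy => /(_ _ e0)[N _ NP].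
  exists (maxn N n) => m; rewrite geq_max => /andP[Nm nm].
  by eexists; [exact: (S_forth Kal nm Sx)|exact: NP].
rewrite -[leLHS](cvg_lim (@Rhausdorff R) (cvg_norm (cvgB (cvg_cst x) cy))).
apply: limr_le.
  by apply: cvgP; apply: (cvg_norm (cvgB (cvg_cst x) cy)).
by exists n => // m /= nm; exact: Dy.
Qed.

Let L_S n x e : L x -> 0 < e -> exists2 y, S n y & `|x - y| <= rho - r n + e.
Proof.
move=> Lx e0; have [N /(_ (maxn N n))] := Lx e e0.
rewrite leq_maxl => /(_ isT)[y Sy xy].
have [z Sz yz] := S_back (leq_maxr N n) Sy.
exists z => //; rewrite (le_trans (ler_distD y _ _))// addrC lerD//.
  by rewrite (le_trans yz)// lerD2r.
exact: ltW.
Qed.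

Let L_compact : compact L.
Proof.
apply: (@subclosed_compact _ _ `[- (rho + 1), rho + 1]).
- move=> x clx e e0.
  have e20 : 0 < e / 2 by rewrite divr_gt0.
  have [z [Lz]] := clx _ (nbhsx_ballx x _ e20).
  rewrite -ball_normE /= => xz.
  have [N NP] := Lz _ e20; exists N => m /NP[y Sy zy]; exists y => //.
  by rewrite (le_lt_trans (ler_distD z _ _))// (splitr e) ltrD.
- exact: segment_compact.
- move=> x Lx; rewrite /= in_itv/= -ler_norml.
  have [N /(_ N (leqnn _))[z Sz xz]] := Lx 1 ltr01.
  by have := ler_normD (x - z) z; have := S_bound Sz; rewrite subrK; lra.
Qed.

Lemma cvg_powser_image : powser_partial_set a K @ \oo --> powser_image a K.
Proof.
have L0 : L !=set0.
  have [x Sx] := powser_partial_neq0 a 0 (carrier_neq0 K).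
  by have [y Ly _] := S_L Sx; exists y.
pose M : compacts [set: R] := Compacts L0 L_compact (@subsetT _ _).
suff cM : powser_partial_set a K @ \oo --> M.
  by apply: cvgP cM.
apply/metricType_numDomainType.cvgrPdist_lt => e e0.
have e20 : 0 < e / 2 by rewrite divr_gt0.
have /cvgrPdist_lt/(_ _ e20)[N _ NP] : r @ \oo --> rho.
  by rewrite (cvg_shiftS (series (fun i => `|a i|))); exact: r_cvg.
exists N => // n /= Nn.
have rn : rho - r n < e / 2 by have := NP _ Nn; apply: le_lt_trans; exact: ler_norm.
apply: (@le_lt_trans _ _ (rho - r n)); last by lra.
apply/hausdorff_dist_leP; split=> x /= h.
  apply/ler_addgt0Pr => d d0; have [y Sy xy] := L_S n h d0.
  by rewrite (le_trans (dist_set_le x Sy)).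
have [y Ly xy] := S_L h.
by rewrite (le_trans (dist_set_le x Ly)).
Qed.

End powser_image_cvg.

Local Open Scope ereal_scope.

Definition diam (R : realType) (A : set R) : \bar R :=
  ereal_sup [set `|x - y|%:E | x in A & y in A].

(* The empty set contributes 0 to a covering sum for every exponent, including
   s = 0, whereas a nonempty set of diameter 0 contributes 0 `^ 0 = 1. *)
Definition diam_pow (R : realType) (s : R) (A : set R) : \bar R :=
  if A == set0 then 0 else diam A `^ s.

Definition hausdorff_premeasure (R : realType) (s delta : R) (A : set R) :
    \bar R :=
  ereal_inf [set \sum_(0 <= i <oo) diam_pow s (U i) | U in
    [set U : (set R)^nat | (forall i, diam (U i) <= delta%:E) /\
                           A `<=` \bigcup_i U i]].

Definition hausdorff_measure (R : realType) (s : R) (A : set R) : \bar R :=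
  ereal_sup [set hausdorff_premeasure s delta A | delta in
    [set delta : R | (0 < delta)%R]].

Definition hausdorff_dim (R : realType) (A : set R) : \bar R :=
  ereal_inf [set s%:E | s in
    [set s : R | (0 <= s)%R /\ hausdorff_measure s A = 0]].

(* Main.v *)
Require Import Defs.
From mathcomp Require Import all_boot all_order all_algebra.
From mathcomp Require Import all_classical all_reals all_analysis.
From mathcomp Require Import finmap lra ring zify.

(** If F is a finite set of m points in [0, 1], the partial Minkowski sum of
    degree n over F is finite, and its cardinality is only about n ^ (m n):
    a product of i elements of F is determined by how often each point of F
    occurs in it, so the i-fold product set has at most (i + 1) ^ m elements
    ([powser_partial_enum]), rather than m ^ i.  The decay hypothesis says
    that |a_i| <= i ^ (- M i) eventually, for every M, so f[F] lies within
    about n ^ (- M n) of that partial sum.  Since M may be taken much larger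
    than m, these few points cover f[F] at a scale so small that, for any
    given exponent s > 0, the covering sum is tiny.

    One such cover, at one scale, persists for f[K] when K is close enough to
    F, because for a fixed degree the partial sum depends continuously on the
    set ([powser_partial_thickening]) and the tail estimate is uniform over
    the subsets of [0, 1] ([powser_image_truncation]).  Hence, for each k, the
    compact sets K such that f[K] has a cover of quality k
    ([finely_coverable]) contain a neighbourhood of every finite set
    ([finely_coverable_near_finite]); finite sets being dense
    ([finite_compacts_dense]), the exceptional K form a nowhere dense set.
    Outside the union over k of these exceptional sets, f[K] has covers of
    every quality, which forces all its Hausdorff measures of positive
    exponent to vanish ([hausdorff_dim_eq0]). *)

Set Implicit Arguments.
Unset Strict Implicit.
Unset Printing Implicit Defensive.

Import Order.TTheory GRing.Theory Num.Theory numFieldNormedType.Exports.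

Local Open Scope classical_set_scope.
Local Open Scope ring_scope.

(** * Thickenings and Minkowski operations *)

(** Inclusions in thickenings are one-sided Hausdorff estimates, free of the
    compactness and nonemptiness conditions that the Hausdorff distance
    needs to be meaningful. *)
Definition thickening {R : realType} (r : R) (B : set R) : set R :=
  [set x | exists2 y, B y & `|x - y| <= r].

Lemma sub_thickening_le {R : realType} (r s : R) (A B : set R) :
  r <= s -> A `<=` thickening r B -> A `<=` thickening s B.
Proof.
by move=> rs AB x /AB[y By xy]; exists y => //; exact: le_trans rs.
Qed.

Lemma sub_thickening_trans {R : realType} (r s : R) (A B C : set R) :
  A `<=` thickening r B -> B `<=` thickening s C ->
  A `<=` thickening (r + s) C.
Proof.
move=> AB BC x /AB[y /BC[z Cz yz] xy]; exists z => //.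
by rewrite (le_trans (ler_distD y _ _))// lerD.
Qed.

Lemma set_add_thickening {R : realType} (r s : R) (A B A' B' : set R) :
  A `<=` thickening r B -> A' `<=` thickening s B' ->
  set_add A A' `<=` thickening (r + s) (set_add B B').
Proof.
move=> AB AB' _ [x /AB[y By xy] [x' /AB'[y' By' xy'] <-]].
exists (y + y'); first by exists y => //; exists y'.
by rewrite opprD addrACA (le_trans (ler_normD _ _))// lerD.
Qed.

Lemma set_scale_thickening {R : realType} (c r : R) (A B : set R) :
  A `<=` thickening r B ->
  set_scale c A `<=` thickening (`|c| * r) (set_scale c B).
Proof.
move=> AB _ [x /AB[y By xy] <-]; exists (c * y); first by exists y.
by rewrite -mulrBr normrM ler_wpM2l.
Qed.

Lemma set_pow_sub_unit {R : realType} (A : set R) n :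
  A `<=` `[0, 1] -> set_pow A n `<=` `[0, 1].
Proof.
move=> A01 _ [al Aal <-].
have al01 j : 0 <= al j <= 1 by have := A01 _ (Aal j); rewrite /= in_itv.
rewrite /= in_itv/=; apply/andP; split.
  by apply: prodr_ge0 => j _; have /andP[] := al01 j.
by apply: prodr_ile1 => j _.
Qed.

(** On [0, 1] the error in a product grows additively: the factors that are
    not being compared only shrink it. *)
Lemma set_pow_thickening {R : realType} (r : R) (A B : set R) n :
  A `<=` `[0, 1] -> B `<=` `[0, 1] -> A `<=` thickening r B ->
  set_pow A n `<=` thickening (n%:R * r) (set_pow B n).
Proof.
move=> A01 B01 AB; elim: n => [|n ih].
  by rewrite !set_pow0 => _ ->; exists 1; rewrite ?subrr ?normr0 ?mul0r.
rewrite !set_powS => _ [x /AB[y By xy] [z Az <-]].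
have [w Bw zw] := ih _ Az; exists (y * w); first by exists y => //; exists w.
have -> : x * z - y * w = (x - y) * z + y * (z - w) by ring.
rewrite (le_trans (ler_normD _ _))// -[n.+1%:R]nat1r [(1 + _) * r]mulrDl mul1r !normrM.
have := set_pow_sub_unit A01 Az; have := B01 _ By.
rewrite /= !in_itv/= => /andP[y0 y1] /andP[z0 z1].
rewrite lerD//; first by rewrite (le_trans _ xy)// ler_piMr// ger0_norm.
by rewrite (le_trans _ zw)// ler_piMl// ger0_norm.
Qed.

(** Continuity in the set of the partial sum of degree n: the error is a
    constant depending only on a and n, times r. *)
Lemma powser_partial_thickening {R : realType} (a : R^nat) (r : R)
    (A B : set R) n :
  A `<=` `[0, 1] -> B `<=` `[0, 1] -> A `<=` thickening r B ->
  powser_partial a A n `<=`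
    thickening (\sum_(i < n.+1) `|a i| * (i%:R * r)) (powser_partial a B n).
Proof.
move=> A01 B01 AB; rewrite /powser_partial.
pose close A B e := A `<=` @thickening R e B.
apply: (big_ind3 close) => [||i _].
- by move=> _ ->; exists 0; rewrite ?subrr ?normr0.
- by move=> C1 C2 e D1 D2 d; exact: set_add_thickening.
- by apply: set_scale_thickening; exact: set_pow_thickening.
Qed.

(** Each dropped summand a_i [A]^i lies in the ball of radius |a_i| around 0,
    so it may be replaced by {0}. *)
Lemma powser_partial_truncation {R : realType} (a : R^nat) (A : set R) n p :
  A `<=` `[0, 1] -> (n <= p)%N ->
  powser_partial a A p `<=`
    thickening (\sum_(n.+1 <= i < p.+1) `|a i|) (powser_partial a A n).
Proof.
move=> A01 /subnKC <-; elim: (p - n)%N => [|k ih].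
  by rewrite addn0 big_geq// => x Ax; exists x; rewrite ?subrr ?normr0.
rewrite addnS powser_partialS big_nat_recr/=; last by rewrite ltnS leq_addr.
rewrite -(set_add0 (powser_partial a A n)) (set_addC [set 0]).
apply: set_add_thickening => // _ [x Ax <-]; exists 0 => //.
have := set_pow_sub_unit A01 Ax; rewrite /= in_itv/= => /andP[x0 x1].
by rewrite subr0 normrM ler_piMr// ger0_norm.
Qed.

(** * Counting the points of a partial sum over a finite set *)

(** By commutativity a product of n entries of s is the monomial in the
    entries of s whose exponents are the multiplicities, and a multiplicity
    is one of 0, ..., n. *)
Lemma set_pow_enum {R : realType} (s : seq R) n :
  exists2 t : seq R, size t = (n.+1 ^ size s)%N &
    set_pow [set` s] n `<=` [set` t].
Proof.
pose f (e : {ffun 'I_(size s) -> 'I_n.+1}) := \prod_(j < size s) s`_j ^+ e j.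
exists [seq f e | e : {ffun 'I_(size s) -> 'I_n.+1}].
  by rewrite size_image card_ffun !card_ord.
move=> _ [al /= sal <-].
have idx i : (index (al i) s < size s)%N by rewrite index_mem sal.
have lt j : (#|[pred i | Ordinal (idx i) == j]| < n.+1)%N.
  by rewrite ltnS (leq_trans (max_card _))// card_ord.
(* the exponent of s`_j is the number of factors equal to s`_j *)
apply/fintype.imageP; exists [ffun j => Ordinal (lt j)] => //.
rewrite /f (partition_big (fun i => Ordinal (idx i)) predT)//=.
apply: eq_bigr => j _; rewrite ffunE /= -prodr_const.
by apply: eq_bigr => i /eqP <-; rewrite /= nth_index.
Qed.

Lemma powser_partial_enum {R : realType} (a : R^nat) (s : seq R) n :
  exists2 t : seq R, size t = (\prod_(i < n.+1) i.+1 ^ size s)%N &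
    powser_partial a [set` s] n `<=` [set` t].
Proof.
rewrite /powser_partial.
pose enumerated (A : set R) (N : nat) :=
  exists2 t : seq R, size t = N & A `<=` [set` t].
apply: (big_ind2 enumerated) => [|A M B N [t <- At] [u <- Bu]|i _].
- by exists [:: 0] => // _ ->; rewrite /= inE.
- exists [seq x + y | x <- t, y <- u]; first by rewrite size_allpairs.
  by move=> _ [x Ax [y By <-]]; apply: allpairs_f; [exact: At|exact: Bu].
- have [t <- st] := set_pow_enum s i.
  exists [seq a i * x | x <- t]; first by rewrite size_map.
  by move=> _ [x sx <-]; apply: map_f; exact: st.
Qed.

(** * Decay of the coefficients *)

Lemma coef_decay {R : realType} (a : R^nat) :
  (lne `|a i|%:E / (i%:R * ln (i%:R : R))%:E)%E @[i --> \oo] --> -oo%E ->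
  forall M, exists N, forall i, (N <= i)%N -> `|a i| <= (i%:R^-1 ^+ M) ^+ i.
Proof.
move=> /cvgeNy_le dec M; have [N _ NP] := dec (- M%:R).
exists (maxn N 2) => i; rewrite geq_max => /andP[Ni i2].
have i0 : 0 < i%:R :> R by rewrite ltr0n; lia.
have lni : 0 < ln (i%:R : R) by rewrite ln_gt0// ltr1n.
have c0 : 0 < i%:R * ln (i%:R : R) by rewrite mulr_gt0.
have [->|ai0] := eqVneq (a i) 0; first by rewrite normr0 !exprn_ge0// invr_ge0 ltW.
have := NP _ Ni; rewrite lne_EFin ?normr_gt0// inver gt_eqF// -EFinM lee_fin.
rewrite ler_pdivrMr// => h.
rewrite -ler_ln ?posrE ?normr_gt0 ?exprn_gt0 ?invr_gt0//.
rewrite -exprM lnXn ?invr_gt0// lnV ?posrE// -[leRHS]mulr_natr natrM.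
by rewrite (le_trans h)// le_eqVlt; apply/orP; left; apply/eqP; ring.
Qed.

Lemma sum_geometric_le {R : realType} (q : R) n p :
  0 <= q <= 2^-1 -> \sum_(n <= i < p) q ^+ i <= 2 * q ^+ n.
Proof.
move=> /andP[q0 q2]; have [np|/ltnW pn] := leqP n p; last first.
  by rewrite big_geq// mulr_ge0// exprn_ge0.
apply: (@le_trans _ _ (2 * q ^+ n - 2 * q ^+ p)); last first.
  by rewrite gerBl mulr_ge0// exprn_ge0.
rewrite -(subnKC np); elim: (p - n)%N => [|k ih].
  by rewrite addn0 big_geq// subrr.
rewrite addnS big_nat_recr ?leq_addr//= exprS.
by have := exprn_ge0 (n + k) q0; nra.
Qed.

(** * Hausdorff dimension zero from very fine finite covers *)

(** The cover of A by intervals of length eta ^ (k + 1) has (k + 1)^-1-power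
    sum (size s) * eta, which is at most (k + 1)^-1; writing the length as a
    power of eta avoids real exponents.  The successor in (size s).+1 makes
    eta itself at most (k + 1)^-1, so the cover is also fine. *)
Definition finely_coverable {R : realType} (k : nat) (A : set R) : Prop :=
  exists (s : seq R) (eta : R),
    [/\ 0 < eta, A `<=` thickening (eta ^+ k.+1 / 2) [set` s] &
        (size s).+1%:R * eta <= k.+1%:R^-1].

Lemma diam_pow_ge0 {R : realType} (s : R) (A : set R) :
  (0 <= diam_pow s A)%E.
Proof. by rewrite /diam_pow; case: ifP => // _; exact: poweR_ge0. Qed.

Lemma diam_pow_le {R : realType} (s d : R) (A : set R) :
  0 <= s -> 0 <= d -> (diam A <= d%:E)%E -> (diam_pow s A <= (d `^ s)%:E)%E.
Proof.
move=> s0 d0 Ad; rewrite /diam_pow; case: ifPn => [_|/set0P[x Ax]].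
  by rewrite lee_fin powR_ge0.
have diam0 : (0 <= diam A)%E.
  by apply: ereal_sup_ubound; exists x => //; exists x => //; rewrite subrr normr0.
by rewrite -poweR_EFin gt0_ler_poweR// in_itv/= leey ?andbT.
Qed.

Lemma diam_thickening1 {R : realType} (r x : R) :
  (diam (thickening r [set x]) <= (2 * r)%:E)%E.
Proof.
apply: ge_ereal_sup => _ [y [_ -> yx] [z [_ -> zx] <-]].
rewrite lee_fin (le_trans (ler_distD x _ _))// mulr_natl mulr2n.
by rewrite lerD// distrC.
Qed.

Lemma hausdorff_premeasure_ge0 {R : realType} (s d : R) (A : set R) :
  (0 <= hausdorff_premeasure s d A)%E.
Proof.
apply: le_ereal_inf_tmp => _ [U _ <-].
by apply: nneseries_ge0 => i _ _; exact: diam_pow_ge0.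
Qed.

(** The witness is the sequence of the intervals of radius r around the
    entries of t, continued by empty sets, which contribute 0. *)
Lemma hausdorff_premeasure_le_enum {R : realType} (s r d : R) (t : seq R)
    (A : set R) :
  0 <= s -> 0 <= r -> 2 * r <= d -> A `<=` thickening r [set` t] ->
  (hausdorff_premeasure s d A <= ((size t)%:R * (2 * r) `^ s)%:E)%E.
Proof.
move=> s0 r0 rd At.
pose U i := if (i < size t)%N then thickening r [set t`_i] else set0.
have U_out i : (size t <= i)%N -> U i = set0 by rewrite /U leqNgt => /negbTE ->.
have Ud i : (diam (U i) <= (2 * r)%:E)%E.
  rewrite /U; case: ifP => _; first exact: diam_thickening1.
  by apply: ge_ereal_sup => _ [x []].
apply: (@le_trans _ _ (\sum_(0 <= i <oo) diam_pow s (U i))%E).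
  apply: ereal_inf_lbound; exists U => //; split=> [i|x /At[y /= ty xy]].
    by rewrite (le_trans (Ud i))// lee_fin.
  exists (index y t) => //; rewrite /U index_mem ty; exists y => //=.
  by rewrite nth_index.
rewrite (nneseries_split 0 (size t)) => [|i _]; last exact: diam_pow_ge0.
rewrite add0n [X in (_ + X)%E]eseries0 => [|i ti _]; last first.
  by rewrite U_out// /diam_pow eqxx.
rewrite adde0 big_mkord (@le_trans _ _ (\sum_(i < size t) ((2 * r) `^ s)%:E)%E)//.
  by apply: lee_sum => i _; apply: diam_pow_le => //; rewrite mulr_ge0.
by rewrite sumEFin sumr_const card_ord [_ * _ `^ _]mulr_natl.
Qed.

(** For an exponent s > 0, covers of quality k with (k + 1)^-1 <= s are good
    enough: as eta <= 1, the s-th power of eta ^ (k + 1) is at most eta. *)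
Lemma hausdorff_dim_eq0 {R : realType} (A : set R) :
  (forall k, finely_coverable k A) -> hausdorff_dim A = 0%E.
Proof.
move=> fineA.
have null (s : R) : 0 < s -> hausdorff_measure s A = 0%E.
  move=> s0; apply/eqP; rewrite eq_le; apply/andP; split; last first.
    apply: le_trans (hausdorff_premeasure_ge0 s 1 A) _.
    by apply: ereal_sup_ubound; exists 1 => /=.
  apply: ge_ereal_sup => _ [d /= d0 <-]; apply/lee_addgt0Pr => e e0.
  rewrite add0e.
  (* k is large for the exponent s, the mesh d and the precision e at once *)
  pose m := Num.min s (Num.min d e).
  have m0 : 0 < m by rewrite /m !lt_min s0 d0.
  pose k := Num.trunc m^-1.
  have km : k.+1%:R^-1 <= m.
    by rewrite -(invrK m) lef_pV2 ?posrE ?invr_gt0// ltW// truncnS_gt.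
  have [t [eta [eta0 At teta]]] := fineA k.
  have : k.+1%:R^-1 <= s /\ k.+1%:R^-1 <= d /\ k.+1%:R^-1 <= e.
    by move: km; rewrite /m !le_min => /and3P[].
  move=> [ks [kd ke]].
  have teta' : (size t)%:R * eta <= k.+1%:R^-1.
    by rewrite (le_trans _ teta)// ler_wpM2r ?ltW// ltr_nat.
  have etak : eta <= k.+1%:R^-1.
    by rewrite (le_trans _ teta)// ler_peMl ?ler1n ?ltW.
  have eta1 : eta <= 1 by rewrite (le_trans etak)// invf_le1 ?ltr0n ?ler1n.
  have half : 2 * (eta ^+ k.+1 / 2) = eta ^+ k.+1 by field.
  have eta_ge0 := ltW eta0.
  apply: le_trans (hausdorff_premeasure_le_enum (ltW s0) _ _ At) _.
  - by rewrite divr_ge0 ?exprn_ge0.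
  - by rewrite half exprS (le_trans _ (le_trans etak kd))// ler_piMr ?exprn_ile1.
  rewrite half lee_fin (le_trans _ (le_trans teta' ke))// ler_wpM2l//.
  rewrite -powR_mulrn// -powRrM -[leRHS]powRr1//.
  rewrite ger_powR ?eta0//.
  by rewrite -ler_pdivrMl ?ltr0n// mulr1.
apply/eqP; rewrite eq_le; apply/andP; split; last first.
  by apply: le_ereal_inf_tmp => _ [s /= [s0 _] <-]; rewrite lee_fin.
apply/lee_addgt0Pr => e e0; rewrite add0e.
by apply: ereal_inf_lbound; exists e => //=; split; [exact: ltW|exact: null].
Qed.

(** * Images of compact sets close to a finite set *)

Lemma hausdorff_dist_thickening {R : realType} {X : set R}
    (K L : compacts X) (e : R) :
  hausdorff_dist K L < e -> (K : set R) `<=` thickening e L.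
Proof.
move=> KLe x Kx; have [KL _] := (hausdorff_dist_leP K L _).1 (lexx _).
have [y Ly xy] := dist_set_lt (carrier_neq0 L) (le_lt_trans (KL _ Kx) KLe).
by exists y => //; exact: ltW.
Qed.

(** The error is that of [powser_partial_truncation], up to an arbitrarily
    small e spent on replacing the limit f[K] by a partial sum. *)
Lemma powser_image_truncation {R : realType} (a : R^nat)
    (a_cvg : forall x : R, 0 <= x <= 1 ->
      cvgn [normed series (fun i => a i * x ^+ i)])
    (K : compacts (`[0, 1] : set R)) (n : nat) (t e : R) :
  (forall p, \sum_(n.+1 <= i < p) `|a i| <= t) -> 0 < e ->
  (powser_image a K : set R) `<=` thickening (e + t) (powser_partial a K n).
Proof.
move=> tail e0.
have /metricType_numDomainType.cvgrPdist_lt/(_ _ e0)[N _ NP] :=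
  cvg_powser_image (K := K) a_cvg.
have /= KNn := NP (maxn N n) (leq_maxl _ _).
apply: (sub_thickening_trans (hausdorff_dist_thickening KNn)) => /=.
apply: sub_thickening_le (tail (maxn N n).+1) _.
by apply: powser_partial_truncation; [exact: carrier_sub|exact: leq_maxr].
Qed.

(** With m points in F and b = (n + 1) ^ (n + 1), the partial sum of degree n
    over F has at most b ^ m points, whereas f[K] stays within a constant times
    b ^ (- (m + 1)(k + 1)) of it.  So eta may be of the order of
    b ^ (- (m + 1)), and b ^ m * eta is of the order of b^-1, which tends to 0
    as n grows. *)
Lemma finely_coverable_near_finite {R : realType} (a : R^nat)
    (a_cvg : forall x : R, 0 <= x <= 1 ->
      cvgn [normed series (fun i => a i * x ^+ i)])
    (a_decay :
      (lne `|a i|%:E / (i%:R * ln (i%:R : R))%:E)%E @[i --> \oo] --> -oo%E)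
    (F : compacts (`[0, 1] : set R)) (s : seq R) (k : nat) :
  (F : set R) = [set` s] ->
  exists2 e : R, 0 < e & forall K : compacts (`[0, 1] : set R),
    hausdorff_dist K F < e -> finely_coverable k (powser_image a K).
Proof.
move=> Fs; set m := size s; pose M := (m.+1 * k.+1)%N.
have [N aN] := coef_decay a_decay M.
(* 16 = 2 * 8: 8 is the constant in eta, and 2 absorbs the successor in
   (size t).+1 *)
pose n := maxn N (16 * k.+1).
have [Nn kn] : (N <= n)%N /\ (16 * k.+1 <= n)%N.
  by rewrite leq_maxl leq_maxr.
pose c : R := n.+1%:R; pose b := c ^+ n.+1; pose rho := (b ^+ M)^-1.
have c1 : 1 <= c by rewrite ler1n.
have c0 : 0 < c by rewrite ltr0n.
have cV0 : 0 <= c^-1 by rewrite invr_ge0 ltW.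
have cb : c <= b by rewrite /b ler_eXnr.
have b1 : 1 <= b by exact: le_trans cb.
have b0 : 0 < b by rewrite exprn_gt0.
have rho0 : 0 < rho by rewrite invr_gt0 exprn_gt0.
(* rho = q ^ (n + 1) for q = (n + 1) ^ (- M), and |a_i| <= q ^ i for i > n:
   the tail is dominated by a geometric series of ratio q <= 1/2 *)
have tail p : \sum_(n.+1 <= i < p) `|a i| <= 2 * rho.
  have -> : rho = (c^-1 ^+ M) ^+ n.+1.
    by rewrite /rho /b exprAC -!exprVn.
  apply: le_trans (sum_geometric_le _ p _); last first.
    rewrite exprn_ge0 ?cV0//= /M mulSn addSn exprS.
    rewrite (@le_trans _ _ c^-1)//.
      by rewrite ler_piMr ?exprn_ile1 ?cV0// invf_le1.
    by rewrite lef_pV2 ?posrE// ler_nat ltnS; lia.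
  apply: ler_sum_nat => i /andP[ni _]; apply: le_trans (aN i _) _; first by lia.
  have i0 : 0 < i%:R :> R by rewrite ltr0n; lia.
  have iV0 : 0 <= i%:R^-1 :> R by rewrite invr_ge0 ltW.
  by rewrite !lerXn2r ?nnegrE ?exprn_ge0// lef_pV2 ?posrE// ler_nat.
pose D := \sum_(i < n.+1) `|a i| * i%:R.
have D0 : 0 <= D by apply: sumr_ge0 => i _; rewrite mulr_ge0.
have [t tN st] := powser_partial_enum a s n.
exists (rho / (D + 1)) => [|K KF]; first by rewrite divr_gt0// ltr_wpDl.
have F01 : (F : set R) `<=` `[0, 1] by exact: carrier_sub.
have K01 : (K : set R) `<=` `[0, 1] by exact: carrier_sub.
(* limit and tail cost rho + 2 rho, moving from K to F costs rho *)
have cover : (powser_image a K : set R) `<=` thickening (4 * rho) [set` t].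
  apply: (@sub_thickening_le _ ((rho + 2 * rho) + rho)); first by lra.
  have imK := powser_image_truncation a_cvg (K := K) tail rho0.
  apply: (sub_thickening_trans imK).
  have := powser_partial_thickening (a := a) (n := n) K01 F01
    (hausdorff_dist_thickening KF).
  rewrite Fs => KFn x /KFn[y /st ty xy]; exists y => //; apply: le_trans xy _.
  under eq_bigr do rewrite mulrA.
  by rewrite -mulr_suml -/D mulrCA ler_piMr ?(ltW rho0)// ler_pdivrMr; lra.
(* 8 suffices for every k: half of 8 ^ (k + 1) is at least 4 *)
exists t, (8 / b ^+ m.+1); split.
- by rewrite divr_gt0// exprn_gt0.
- apply: sub_thickening_le cover.
  rewrite expr_div_n -exprM -/M -/rho mulrAC ler_wpM2r ?(ltW rho0)//.
  rewrite ler_pdivlMr// exprS.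
  have : 1 <= 8 ^+ k :> R by rewrite exprn_ege1// ler1n.
  by lra.
have tb : (size t)%:R <= b ^+ m.
  rewrite tN /b -exprM mulnC exprM -natrX.
  rewrite -[X in _ ^+ X]card_ord -prodr_const -natr_prod ler_nat.
  apply: leq_prod => i _; rewrite -/m.
  by case: (m) => [|l]; rewrite ?expn0 ?leq_exp2r.
have tb' : (size t).+1%:R <= 2 * b ^+ m.
  by rewrite -natr1 mulr_natl mulr2n lerD// exprn_ege1.
apply: (@le_trans _ _ (16 / b)).
  rewrite exprS invfM; have bm0 : 0 < b ^+ m by rewrite exprn_gt0.
  apply: le_trans (ler_wpM2r _ tb') _.
    by rewrite !mulr_ge0 ?invr_ge0// ltW.
  rewrite le_eqVlt; apply/orP; left; apply/eqP; field.
  by rewrite !gt_eqF.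
rewrite ler_pdivrMr// -ler_pdivrMl ?invr_gt0 ?ltr0n// invrK mulrC.
by rewrite (le_trans _ cb)// -natrM ler_nat; lia.
Qed.

(** * Genericity *)

(** A finite set of centres of balls covering K, chosen inside K, is close to K
    on both sides. *)
Lemma finite_compacts_dense {R : realType} {X : set R} (K : compacts X)
    (e : R) : 0 < e ->
  exists (F : compacts X) (s : seq R),
    (F : set R) = [set` s] /\ hausdorff_dist K F < e.
Proof.
move=> e0; have e20 : 0 < e / 2 by rewrite divr_gt0.
have := carrier_compact K; rewrite compact_cover.
move=> /(_ R K (fun x => ball x (e / 2)))[||D DK KD].
- by move=> x _; exact: ball_open.
- by move=> x Kx; exists x => //; exact: ballxx.
have subDK x : x \in D -> carrier K x by move=> /DK /set_mem.
have D0 : [set` enum_fset D] !=set0.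
  by have [x /KD[y Dy _]] := carrier_neq0 K; exists y.
have Dc : compact [set` enum_fset D].
  by apply: finite_compact; exact: finite_seq.
have DX : [set` enum_fset D] `<=` X.
  by move=> x /subDK; exact: carrier_sub.
exists (Compacts D0 Dc DX), (enum_fset D); split=> //.
apply: (@le_lt_trans _ _ (e / 2)); last by lra.
apply/hausdorff_dist_leP; split=> x /=.
  move=> /KD[y Dy]; rewrite /ball/= => yx.
  by rewrite (le_trans (dist_set_le x Dy))// distrC ltW.
by move=> /subDK Kx; rewrite (le_trans (dist_set_le x Kx))// subrr normr0 ltW.
Qed.

Theorem theorem5p1 (R : realType) (a : R^nat)
    (a_cvg : forall x : R, 0 <= x <= 1 ->
      cvgn [normed series (fun i => a i * x ^+ i)])
    (a_decay :
      (lne `|a i|%:E / (i%:R * ln (i%:R : R))%:E)%E @[i --> \oo] --> -oo%E) :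
  meager [set K : compacts (`[0, 1] : set R) |
           hausdorff_dim (powser_image a K) <> 0%E].
Proof.
exists (fun k => [set K | ~ finely_coverable k (powser_image a K)]); last first.
  move=> K /= dimK; apply: contrapT => fineK; apply: dimK.
  apply: hausdorff_dim_eq0 => k; apply: contrapT => nk.
  by apply: fineK; exists k.
move=> k; apply/seteqP; split=> // K.
move=> /nbhs_ballP[e /= e0 eK].
have [F [s [Fs KF]]] := finite_compacts_dense K e0.
have [d d0 dF] := finely_coverable_near_finite a_cvg a_decay k Fs.
have /eK/(_ _ (nbhsx_ballx F d d0))[L [nL FL]] : ball K e F by exact: KF.
by apply: nL; apply: dF; rewrite hausdorff_dist_sym; exact: FL.
Qed.
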